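(* Suppose that the real parameters $(\sigma,\rho,s,\tau,\varepsilon)$ satisfy $$s>0,\quad \sigma>\frac1s,\quad (\sigma s-1)(\rho s-1)-\tau^2\varepsilon^2>0,\quad \varepsilon\in\mathbb{R},\quad \tau\in\mathbb{R}\setminus\{0\},$$ and let $\{w^{k}\}$, $w^k=(x^k,y^k,\lambda^k)$, be the sequence generated by the Parameterized Proximal Point Algorithm (P-PPA) described in the context, from an arbitrary starting point $(x^0,y^0,\lambda^0)\in\mathbb{R}^m\times\mathbb{R}^n\times\mathbb{R}^l$. Then there exists $w^\infty\in\mathcal{M}^*$ such that $$\lim_{k\to\infty} w^k=w^\infty .$$
   Context: Problem: minimize $f(x)+g(y)$ subject to $Ax+By=c$, $x\in\mathcal{X}$, $y\in\mathcal{Y}$, where $f:\mathbb{R}^m\to\mathbb{R}$ and $g:\mathbb{R}^n\to\mathbb{R}$ are closed proper convex functions (not necessarily smooth), $A\in\mathbb{R}^{l\times m}$, $B\in\mathbb{R}^{l\times n}$, $c\in\mathbb{R}^l$, and $\mathcal{X}\subset\mathbb{R}^m$, $\mathcal{Y}\subset\mathbb{R}^n$ are closed convex sets. Standing assumptions: the solution set of the problem is nonempty, and $A$ and $B$ have full column rank. Variational inequality: for $\tau\neq0$ put $\mathcal{M}=\mathcal{X}\times\mathcal{Y}\times\mathbb{R}^l$; for $w=(x,y,\lambda)$ put $u=(x,y)$, $\phi(u)=f(x)+g(y)$ and $$\mathcal{J}(w)=\tau\begin{pmatrix}-A^T\lambda\\ -B^T\lambda\\ Ax+By-c\end{pmatrix}.$$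 $\mathcal{M}^*$ denotes the set of all $w^*=(x^*,y^*,\lambda^* )\in\mathcal{M}$ (with $u^*=(x^*,y^* )$) such that $\phi(u)-\phi(u^* )+\langle w-w^*,\mathcal{J}(w^* )\rangle\ge0$ for all $w\in\mathcal{M}$. It is a standing assumption that $\mathcal{M}^*$ is nonempty. Algorithm (P-PPA): let $\bar\sigma=\sigma+\frac{\tau^2-1}{s}$ and $\bar\rho=\rho+\frac{\tau^2-1}{s}$. Choose $(x^0,y^0,\lambda^0)\in\mathbb{R}^m\times\mathbb{R}^n\times\mathbb{R}^l$ and set $\bar\lambda^0=\lambda^0-\frac{\tau+\varepsilon}{s}(Ax^0+By^0-c)$. For $k=0,1,2,\dots$ compute 1. $x^{k+1}=\arg\min_{x\in\mathcal{X}}\{f(x)+\frac{\bar\sigma}{2}\|A(x-x^k)-\frac{\tau}{\bar\sigma}\bar\lambda^k\|^2\}$; 2. $\bar\lambda^{k+\frac12}=\bar\lambda^k-\frac{\tau-\varepsilon}{s}[A(2x^{k+1}-x^k)+By^k-c]$; 3. $y^{k+1}=\arg\min_{y\in\mathcal{Y}}\{g(y)+\frac{\bar\rho}{2}\|B(y-y^k)-\frac{\tau}{\bar\rho}\bar\lambda^{k+\frac12}\|^2\}$; 4. $r^{k+1}=Ax^{k+1}+By^{k+1}-c$; 5. $\bar\lambda^{k+1}=\bar\lambda^k-\frac{\tau}{s}r^{k+1}-\frac1s[\tau A(x^{k+1}-x^k)+\varepsilon B(y^{k+1}-y^k)]$. The multiplier $\lambda^k$ is related to $\bar\lambda^k$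 by $\bar\lambda^k=\lambda^k-\frac{\tau+\varepsilon}{s}(Ax^k+By^k-c)$; equivalently, $\lambda^{k+1}=\lambda^k-\frac1s[(\tau-\varepsilon)Ax^{k+1}+\varepsilon Ax^k+\tau By^k-\tau c]$. The iterate is $w^k=(x^k,y^k,\lambda^k)$. Here $\|\cdot\|$ is the Euclidean norm and $\langle\cdot,\cdot\rangle$ the standard inner product. *)

(* Defs.v *)
From HB Require Import structures.
From mathcomp Require Import all_boot all_order all_algebra.
From mathcomp Require Import all_classical all_reals all_analysis.

Set Implicit Arguments.
Unset Strict Implicit.
Unset Printing Implicit Defensive.

Import Order.TTheory GRing.Theory Num.Theory.
Import numFieldNormedType.Exports.

Local Open Scope classical_set_scope.
Local Open Scope ring_scope.

Definition inner {R : realType} {d : nat} (u v : 'cV[R]_d) : R :=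
  \sum_(i < d) u i 0 * v i 0.

(* The library's norm on matrices is the sup norm, hence this one. *)
Definition enorm {R : realType} {d : nat} (u : 'cV[R]_d) : R :=
  Num.sqrt (inner u u).

Definition full_column_rank {R : realType} {l d : nat} (A : 'M[R]_(l, d)) :
  Prop := \rank A = d.

Definition proper_function {R : realType} {T : Type} (h : T -> \bar R) : Prop :=
  (forall x, h x != -oo%E) /\ (exists x, h x != +oo%E).

Definition closed_proper_convex {R : realType} {d : nat}
    (h : 'cV[R]_d -> R) : Prop :=
  [/\ lower_semicontinuous (EFin \o h), proper_function (EFin \o h)
    & convex_function [set: convex_lmodType 'cV[R]_d] h].

Definition is_argmin {R : realType} {T : Type} (D : set T) (F : T -> R)
    (x : T) : Prop :=
  D x /\ (forall z, D z -> F x <= F z).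

Section problem.
Context {R : realType} {l m n : nat}.
Variables (f : 'cV[R]_m -> R) (g : 'cV[R]_n -> R).
Variables (A : 'M[R]_(l, m)) (B : 'M[R]_(l, n)) (c : 'cV[R]_l).
Variables (X : set 'cV[R]_m) (Y : set 'cV[R]_n).

Definition phi (u : 'cV[R]_m * 'cV[R]_n) : R := f u.1 + g u.2.

Definition feasible : set ('cV[R]_m * 'cV[R]_n) :=
  [set u | [/\ X u.1, Y u.2 & A *m u.1 + B *m u.2 = c]].

Definition solution_set : set ('cV[R]_m * 'cV[R]_n) :=
  [set u | is_argmin feasible phi u].

(* Triples are nested to the left: in w = (x, y, lambda), w.1 is u = (x, y). *)
Definition winner (v w : 'cV[R]_m * 'cV[R]_n * 'cV[R]_l) : R :=
  inner v.1.1 w.1.1 + inner v.1.2 w.1.2 + inner v.2 w.2.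

Definition Mset : set ('cV[R]_m * 'cV[R]_n * 'cV[R]_l) := X `*` Y `*` setT.

Definition Jop (tau : R) (w : 'cV[R]_m * 'cV[R]_n * 'cV[R]_l) :
    'cV[R]_m * 'cV[R]_n * 'cV[R]_l :=
  tau *: (- (A^T *m w.2), - (B^T *m w.2), A *m w.1.1 + B *m w.1.2 - c).

Definition Mstar (tau : R) : set ('cV[R]_m * 'cV[R]_n * 'cV[R]_l) :=
  [set ws | Mset ws /\ forall w, Mset w ->
     0 <= phi w.1 - phi ws.1 + winner (w - ws) (Jop tau ws)].

(* pbar s tau sigma is sigma-bar and pbar s tau rho is rho-bar. *)
Definition pbar (s tau p : R) : R := p + (tau ^+ 2 - 1) / s.

(* lamb k is lambda-bar^k and lambh k is lambda-bar^(k+1/2).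
   At k = 0, pppa_lamb is the initialisation of lambda-bar^0; at k.+1 it
   recovers lambda^(k+1) from lambda-bar^(k+1). The starting point
   (x 0, y 0, lam 0) is unconstrained, and need not lie in X and Y. *)
Record PPPA (sigma rho s tau eps : R)
    (x : nat -> 'cV[R]_m) (y : nat -> 'cV[R]_n)
    (lam lamb lambh r : nat -> 'cV[R]_l) : Prop := {
  pppa_lamb : forall k,
    lamb k = lam k - ((tau + eps) / s) *: (A *m x k + B *m y k - c) ;
  pppa_x : forall k,
    is_argmin X
      (fun z => f z + pbar s tau sigma / 2 *
         enorm (A *m (z - x k) - (tau / pbar s tau sigma) *: lamb k) ^+ 2)
      (x k.+1) ;
  pppa_lambh : forall k,
    lambh k = lamb k
      - ((tau - eps) / s) *: (A *m (2 *: x k.+1 - x k) + B *m y k - c) ;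
  pppa_y : forall k,
    is_argmin Y
      (fun z => g z + pbar s tau rho / 2 *
         enorm (B *m (z - y k) - (tau / pbar s tau rho) *: lambh k) ^+ 2)
      (y k.+1) ;
  pppa_r : forall k,
    r k.+1 = A *m x k.+1 + B *m y k.+1 - c ;
  pppa_lambS : forall k,
    lamb k.+1 = lamb k - (tau / s) *: r k.+1
      - s^-1 *: (tau *: (A *m (x k.+1 - x k)) + eps *: (B *m (y k.+1 - y k)))
}.

End problem.

(* Main.v *)
Require Import Defs.
From HB Require Import structures.
From mathcomp Require Import all_boot all_order all_algebra.
From mathcomp Require Import all_classical all_reals all_analysis.
From mathcomp Require Import ring lra.

Import Order.TTheory GRing.Theory Num.Theory.
Import numFieldNormedType.Exports.

Local Open Scope classical_set_scope.
Local Open Scope ring_scope.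

(** The algorithm is a proximal point method in disguise. Write
v^k = (A x^k, B y^k, lambda^k). Each subproblem minimizes a convex function plus
a quadratic, hence satisfies a variational inequality ([argmin_prox_vi]). Once
the auxiliary multipliers are eliminated, the sum of the two inequalities reads,
for all w in M with image v = (A x, B y, lambda),

  phi(u) - phi(u^(k+1)) + <w - w^(k+1), J(w^(k+1))>
    + <v - v^(k+1), H (v^(k+1) - v^k)> >= 0

with a symmetric matrix H ([pppa_residual_form], [pppa_vi]). A Schur complement
shows that the conditions on the parameters make H positive definite
([prox_form_coercive]).

Take w = w* in M^* here, add the inequality that defines w*, tested at w^(k+1),
and use that J is skew up to a constant. What remains is the Fejer inequality
|v^(k+1) - v*|_H^2 <= |v^k - v*|_H^2 - |v^(k+1) - v^k|_H^2
([fejer_prox_form]). So (v^k) is bounded and its steps tend to 0. In a cluster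
point the last term of the displayed inequality disappears, and closedness of
the constraint sets and of f and g shows that the cluster point comes from an
element of M^* ([pppa_cluster_in_Mstar]). The distance to this element is
monotone too, so the whole sequence (v^k) converges ([fejer_cvg]). Full column
rank of A and B turns convergence of (v^k) into convergence of (w^k), and
expresses a cluster point in the original variables
([cvg_full_column_rank]). *)

(** * Limits, compactness and full column rank *)

Lemma cvg_mxP {R : realType} {T : Type} {F : set_system T} {FF : Filter F}
    {m n : nat} (u : T -> 'M[R]_(m, n)) (a : 'M[R]_(m, n)) :
  u t @[t --> F] --> a <-> forall i j, u t i j @[t --> F] --> a i j.
Proof.
split=> [ua i j|ua]; last first.
  apply/cvg_ballP => e e0.
  have : \forall t \near F, forall ij : 'I_m * 'I_n,
      ball (a ij.1 ij.2) e (u t ij.1 ij.2).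
    by apply: filter_forall => -[i j]; exact: (cvg_ball (ua i j)).
  by apply: filterS => t h; split=> // i j; exact: (h (i, j)).
exact: (cvg_comp u (fun M : 'M[R]_(m, n) => M i j) ua
  (@coord_continuous R m n i j a)).
Qed.

Lemma cvg_mulmx {R : realType} {T : Type} {F : set_system T} {FF : Filter F}
    {l d p : nat} (A : 'M[R]_(l, d))
    (u : T -> 'M[R]_(d, p)) (a : 'M[R]_(d, p)) :
  u t @[t --> F] --> a -> A *m u t @[t --> F] --> A *m a.
Proof.
move=> ua; apply/cvg_mxP => i j; rewrite mxE; under eq_fun do rewrite mxE.
apply: (@cvg_big _ _ +%R) => //; first exact: add_continuous.
by move=> k _; apply: cvgM; [exact: cvg_cst | move/cvg_mxP : ua; apply].
Qed.

Lemma mulVpmx_full_column_rank {R : realType} {l d : nat} (A : 'M[R]_(l, d)) :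
  full_column_rank A -> pinvmx A *m A = 1%:M.
Proof. by move=> rkA; apply: mulVpmx; rewrite /row_full rkA. Qed.

(** A matrix of full column rank has a left inverse, through which a limit of
    the images A *m u t is pulled back to a limit of the vectors u t
    themselves. *)
Lemma cvg_full_column_rank {R : realType} {T : Type} {F : set_system T}
    {FF : Filter F} {l d : nat} (A : 'M[R]_(l, d)) (u : T -> 'cV[R]_d)
    (a : 'cV[R]_l) :
  full_column_rank A -> A *m u t @[t --> F] --> a ->
  u t @[t --> F] --> pinvmx A *m a.
Proof.
move=> /mulVpmx_full_column_rank AK Aua.
have -> : u = (fun t => pinvmx A *m (A *m u t)).
  by apply/funext => t; rewrite mulmxA AK mul1mx.
exact: cvg_mulmx.
Qed.

(** The range of A is closed: a limit a of vectors A *m u t is the image of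
    the limit of u. *)
Lemma mulmx_pinv_lim {R : realType} {T : Type} {F : set_system T}
    {FF : ProperFilter F} {l d : nat} (A : 'M[R]_(l, d)) (u : T -> 'cV[R]_d)
    (a : 'cV[R]_l) :
  full_column_rank A -> A *m u t @[t --> F] --> a ->
  A *m (pinvmx A *m a) = a.
Proof.
move=> rkA Aua; apply/esym/(cvg_unique (@norm_hausdorff _ _) Aua).
exact/cvg_mulmx/cvg_full_column_rank.
Qed.

Lemma inner_ge0 {R : realType} {d : nat} (u : 'cV[R]_d) : 0 <= inner u u.
Proof. by rewrite sumr_ge0// => i _; rewrite -expr2 sqr_ge0. Qed.

Lemma sqr_enorm {R : realType} {d : nat} (u : 'cV[R]_d) :
  enorm u ^+ 2 = inner u u.
Proof. by rewrite sqr_sqrtr// inner_ge0. Qed.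

Lemma inner_mulmx_tr {R : realType} {l d : nat} (A : 'M[R]_(l, d))
    (u : 'cV[R]_d) (p : 'cV[R]_l) : inner u (A^T *m p) = inner (A *m u) p.
Proof.
have E e (a b : 'cV[R]_e) : inner a b = (a^T *m b) 0 0.
  by rewrite mxE; apply: eq_bigr => i _; rewrite mxE.
by rewrite !E trmx_mul mulmxA.
Qed.

Lemma cvg_inner {R : realType} {T : Type} {F : set_system T} {FF : Filter F}
    {d : nat} (u v : T -> 'cV[R]_d) (a b : 'cV[R]_d) :
  u t @[t --> F] --> a -> v t @[t --> F] --> b ->
  inner (u t) (v t) @[t --> F] --> inner a b.
Proof.
move=> ua vb; apply: (@cvg_big _ _ +%R) => //; first exact: add_continuous.
move=> k _; apply: cvgM; [move/cvg_mxP : ua; apply | move/cvg_mxP : vb; apply].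
Qed.

Lemma cV_norm_le {R : realType} {d : nat} (u : 'cV[R]_d) (C : R) :
  0 <= C -> (`|u| <= C) = [forall i, `|u i 0| <= C].
Proof.
move=> C0; rewrite /Num.norm /= mx_normrE.
apply/idP/forallP => [uC i|uC].
  apply: le_trans uC.
  exact: (@le_bigmax _ _ _ 0 (fun ij => `|u ij.1 ij.2|) (i, 0)).
by apply/bigmax_leP; split => // -[i j] _ /=; rewrite ord1; exact: uC.
Qed.

(** The norm that defines the topology is the sup norm; it is bounded by the
    Euclidean norm. *)
Lemma sqr_norm_le_inner {R : realType} {d : nat} (u : 'cV[R]_d) :
  `|u| ^+ 2 <= inner u u.
Proof.
suff : `|u| <= Num.sqrt (inner u u).
  by rewrite -(ler_pXn2r (ltn0Sn 1)) ?nnegrE ?sqrtr_ge0// sqr_sqrtr// inner_ge0.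
rewrite cV_norm_le ?sqrtr_ge0//; apply/forallP => i.
rewrite -sqrtr_sqr; apply: ler_wsqrtr.
rewrite /inner (bigD1 i)//= expr2 lerDl.
by rewrite sumr_ge0// => j _; rewrite -expr2 sqr_ge0.
Qed.

Lemma sqr_norm_triple_le {R : realType} {l : nat}
    (z : 'cV[R]_l * 'cV[R]_l * 'cV[R]_l) :
  `|z| ^+ 2 <= inner z.1.1 z.1.1 + inner z.1.2 z.1.2 + inner z.2 z.2.
Proof.
have := inner_ge0 z.1.1; have := inner_ge0 z.1.2; have := inner_ge0 z.2.
set S := (_ + _ + _) => p3 p2 p1.
have S0 : 0 <= S by rewrite !addr_ge0.
suff : `|z| <= Num.sqrt S.
  by rewrite -(ler_pXn2r (ltn0Sn 1)) ?nnegrE ?sqrtr_ge0// sqr_sqrtr.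
have le_sqrt (u : 'cV[R]_l) : inner u u <= S -> `|u| <= Num.sqrt S.
  move=> uS; rewrite -[leLHS]ger0_norm// -sqrtr_sqr; apply: ler_wsqrtr.
  exact: le_trans (sqr_norm_le_inner u) uS.
by rewrite !prod_normE !ge_max !le_sqrt// /S; lra.
Qed.

(** A segment of the line to the power d is compact, and transposition carries
    this from rows to columns. *)
Lemma compact_cV_ball {R : realType} {d : nat} (C : R) :
  compact [set u : 'cV[R]_d | forall i, `|u i 0| <= C].
Proof.
have -> : [set u : 'cV[R]_d | forall i, `|u i 0| <= C] =
    trmx @` [set v : 'rV[R]_d |
      forall i, (`[- C, C]%classic : set R) (v ord0 i)].
  apply/seteqP; split => [u uC|_ [v vC <-] i] /=.
    exists u^T; last by rewrite trmxK.
    by move=> i /=; rewrite mxE in_itv /= -ler_norml.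
  by rewrite mxE ler_norml; have := vC i; rewrite /= in_itv.
apply: continuous_compact; last first.
  apply: (@rV_compact _ _ (fun=> `[- C, C]%classic)) => i.
  exact: segment_compact.
apply: continuous_subspaceT => v.
apply/(@cvg_mxP _ _ (nbhs v) (nbhs_filter v)) => i j.
by under eq_fun do rewrite mxE; rewrite mxE; exact: coord_continuous.
Qed.

Lemma compact_triple_ball {R : realType} {l : nat} (C : R) :
  compact [set z : 'cV[R]_l * 'cV[R]_l * 'cV[R]_l | `|z| <= C].
Proof.
have [C0|C0] := ltP C 0.
  suff -> : [set z : 'cV[R]_l * 'cV[R]_l * 'cV[R]_l | `|z| <= C] = set0.
    exact: compact0.
  by apply/seteqP; split => // z /= zC; have := normr_ge0 z; lra.
pose K := [set u : 'cV[R]_l | forall i, `|u i 0| <= C].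
suff -> : [set z : 'cV[R]_l * 'cV[R]_l * 'cV[R]_l | `|z| <= C] = K `*` K `*` K.
  by do ?apply: compact_setX; exact: compact_cV_ball.
have KE u : K u = (`|u| <= C) :> Prop.
  by rewrite cV_norm_le//; apply/propext; split => /forallP.
apply/seteqP; split => [z|z [[]]] /=; rewrite !KE !prod_normE !ge_max.
  by move=> /andP[/andP[-> ->] ->].
by move=> -> -> ->.
Qed.

Lemma cvg_triple_proj {T : Type} {F : set_system T} {FF : Filter F}
    {U V W : topologicalType} (w : T -> U * V * W) (a : U * V * W) :
  w t @[t --> F] --> a ->
  [/\ (w t).1.1 @[t --> F] --> a.1.1, (w t).1.2 @[t --> F] --> a.1.2 &
      (w t).2 @[t --> F] --> a.2].
Proof.
have proj (S1 S2 : topologicalType) (u : T -> S1 * S2)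
      (b : S1 * S2) :
    u t @[t --> F] --> b ->
    (u t).1 @[t --> F] --> b.1 /\ (u t).2 @[t --> F] --> b.2.
  move=> ub; split.
    by apply: (cvg_comp u fst ub); exact: cvg_fst.
  by apply: (cvg_comp u snd ub); exact: cvg_snd.
by move=> /proj[/proj[]].
Qed.

Lemma cvg_triple_intro {T : Type} {F : set_system T} {FF : Filter F}
    {U V W : topologicalType} (u : T -> U) (v : T -> V) (w : T -> W)
    (a : U * V * W) :
  u t @[t --> F] --> a.1.1 -> v t @[t --> F] --> a.1.2 ->
  w t @[t --> F] --> a.2 -> (u t, v t, w t) @[t --> F] --> a.
Proof.
case: a => -[a b] c /= ua vb wc.
apply: (@cvg_pair _ _ _ _ (nbhs (a, b)) (nbhs c)) => //.
exact: (@cvg_pair _ _ _ _ (nbhs a) (nbhs b)).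
Qed.

Lemma lsc_sum_le_lim {R : realType} {T1 T2 : topologicalType} {I : Type}
    {F : set_system I} {FF : ProperFilter F} (f : T1 -> R) (g : T2 -> R)
    (u : I -> T1) (v : I -> T2) (a : T1) (b : T2) (h : I -> R) (c : R) :
  lower_semicontinuous (EFin \o f) -> lower_semicontinuous (EFin \o g) ->
  u i @[i --> F] --> a -> v i @[i --> F] --> b -> h i @[i --> F] --> c ->
  (forall i, f (u i) + g (v i) <= h i) -> f a + g b <= c.
Proof.
move=> lf lg ua vb hc le_h; apply/ler_addgt0Pr => e e0.
have near_gt (T : topologicalType) (k : T -> R) (w : I -> T) d :
    lower_semicontinuous (EFin \o k) -> w i @[i --> F] --> d ->
    \forall i \near F, k d - e / 2 < k (w i).
  move=> lk wd; have [|V dV kV] := lk d (k d - e / 2).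
    by rewrite lte_fin gtrBl divr_gt0.
  have wV : \forall i \near F, V (w i) := wd _ dV.
  by apply: filterS wV => i /kV /=; rewrite lte_fin.
suff : f a + g b - e <= c by lra.
rewrite -(cvg_lim _ hc)//.
apply: limr_ge; first by apply/cvg_ex; exists c.
near=> i; apply: le_trans (le_h i).
have : f a - e / 2 < f (u i) by near: i; exact: near_gt.
have : g b - e / 2 < g (v i) by near: i; exact: near_gt.
lra.
Unshelve. all: by end_near. Qed.

(** * Fejer monotone sequences *)

Lemma cluster_cvg_subseq {R : realType} {V : pseudoMetricType R}
    (u : nat -> V) (a : V) : cluster (u k @[k --> \oo]) a ->
  exists2 k : nat -> nat, k j @[j --> \oo] --> \oo &
    u (k j) @[j --> \oo] --> a.
Proof.
move=> cl_a.
have /choice[k kP] j : exists i, (j <= i)%N /\ ball a (j.+1%:R^-1) (u i).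
  have [||_ [[i ji <-] ai]] := cl_a (u @` [set i | (j <= i)%N])
      (ball a (j.+1%:R^-1)).
  - by exists j => // i /= ji; exists i.
  - by apply: nbhsx_ballx; rewrite invr_gt0.
  - by exists i.
exists k.
  move=> P [N _ NP]; exists N => // j /= Nj; apply: NP => /=.
  exact: leq_trans Nj (kP j).1.
apply/cvg_ballP => e e0.
near=> j; apply: le_ball (kP j).2.
apply: ltW; near: j; exact: near_infty_natSinv_lt (PosNum e0).
Unshelve. all: by end_near. Qed.

Lemma cvg0_of_sqr_norm_le {R : realType} {V : normedModType R} {T : Type}
    {F : set_system T} {FF : Filter F} (delta : R) (u : T -> V) (q : T -> R) :
  0 < delta -> (forall t, delta * `|u t| ^+ 2 <= q t) ->
  q t @[t --> F] --> 0 -> u t @[t --> F] --> 0.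
Proof.
move=> d0 uq q0; apply/cvgr0Pnorm_lt => e e0.
have de0 : 0 < delta * e ^+ 2 by rewrite mulr_gt0 ?exprn_gt0.
move/cvgr0Pnorm_lt : q0 => /(_ _ de0); apply: filterS => t qt.
have := le_lt_trans (le_trans (uq t) (ler_norm _)) qt.
by rewrite ltr_pM2l// ltr_pXn2r// ?nnegrE// ltW.
Qed.

(** The Fejer argument behind convergence of the proximal point method, for a
    squared distance q that dominates a multiple of the squared norm. The
    distance from v k to a point of S decreases, so v stays in a compact ball,
    and the amount of decrease bounds the steps, which tend to zero. Hence
    v k.+1 follows v k to every cluster point. Such a point lies in S, so the
    distance to it is monotone as well; as it tends to 0 along a subsequence,
    it does so along the whole sequence. The hypothesis on S speaks of v (k j)
    and v (k j).+1 because an iteration relates consecutive iterates. *)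
Lemma fejer_cvg {R : realType} {V : normedModType R} (q : V -> R) (delta : R)
    (S : set V) (v : nat -> V) :
  0 < delta -> (forall z, delta * `|z| ^+ 2 <= q z) ->
  q 0 = 0 -> {for 0, continuous q} ->
  (forall C : R, compact [set z : V | `|z| <= C]) ->
  S !=set0 ->
  (forall s k, S s -> q (v k.+1 - s) <= q (v k - s) - q (v k.+1 - v k)) ->
  (forall (k : nat -> nat) a, k j @[j --> \oo] --> \oo ->
     v (k j) @[j --> \oo] --> a -> v (k j).+1 @[j --> \oo] --> a -> S a) ->
  exists2 a, S a & v k @[k --> \oo] --> a.
Proof.
move=> d0 dq q00 cq HB [s0 Ss0] fejer clS.
have q_ge0 z : 0 <= q z by apply: le_trans (dq z); rewrite mulr_ge0// ltW.
have dec s : S s -> nonincreasing_seq (fun k => q (v k - s)).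
  move=> Ss; apply/nonincreasing_seqP => k.
  by apply: le_trans (fejer _ _ Ss) _; rewrite gerBl.
have cvq s : S s -> cvgn (fun k => q (v k - s)).
  move=> Ss; apply: nonincreasing_is_cvgn; first exact: dec.
  by exists 0 => _ [k _ <-]; exact: q_ge0.
(* The steps are bounded by the decrease of a convergent sequence. *)
have dv0 : v k.+1 - v k @[k --> \oo] --> 0.
  apply: (@cvg0_of_sqr_norm_le _ _ _ _ _ delta _
    (fun k => q (v k - s0) - q (v k.+1 - s0))) => //.
    by move=> k; apply: le_trans (dq _) _; have := fejer _ k Ss0; lra.
  have /cvg_ex[c qc] := cvq _ Ss0.
  rewrite -(subrr c); apply: cvgB => //.
  by rewrite (cvg_shiftS (fun k => q (v k - s0))).
pose C := Num.sqrt (q (v 0%N - s0) / delta).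
have vC k : `|v k - s0| <= C.
  have q0 := le_trans (dq _) (dec _ Ss0 0%N k (leq0n k)).
  rewrite -[leLHS]ger0_norm// -sqrtr_sqr; apply: ler_wsqrtr.
  by rewrite ler_pdivlMr// mulrC.
have [z [zC clz]] :
    [set z | `|z| <= C] `&` cluster (v k - s0 @[k --> \oo]) !=set0.
  apply: HB; exists 0%N => // k _; exact: vC.
have [k koo kz] := cluster_cvg_subseq _ _ clz.
have vk : v (k j) @[j --> \oo] --> z + s0.
  have -> : (fun j => v (k j)) = (fun j => (v (k j) - s0) + s0).
    by apply/funext => j; rewrite subrK.
  by apply: cvgD => //; exact: cvg_cst.
have vSk : v (k j).+1 @[j --> \oo] --> z + s0.
  have -> : (fun j => v (k j).+1) = (fun j => (v (k j).+1 - v (k j)) + v (k j)).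
    by apply/funext => j; rewrite subrK.
  rewrite -[z + s0]add0r; apply: cvgD => //.
  exact: (cvg_comp k _ koo dv0).
have Sa := clS _ _ koo vk vSk.
exists (z + s0) => //.
(* Along all of v, the distance q (v k - (z + s0)) has a limit c; along the
   subsequence it tends to q 0, hence c = 0. *)
have /cvg_ex[c qc] := cvq _ Sa.
have qkc := cvg_comp k _ koo qc.
have qk0 : q (v (k j) - (z + s0)) @[j --> \oo] --> q 0.
  apply: (cvg_comp (fun j => v (k j) - (z + s0)) q _ cq).
  by rewrite -(subrr (z + s0)); apply: cvgB => //; exact: cvg_cst.
have c0 : c = 0 by rewrite -q00; exact: (cvg_unique _ qkc qk0).
apply/subr_cvg0.
by apply: cvg0_of_sqr_norm_le d0 (fun k => dq (v k - (z + s0))) _; rewrite -c0.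
Qed.

(** * Optimality condition of a proximal subproblem *)

(** Each identity below is a polynomial identity in inner products that holds
    already coordinate by coordinate. This tactic moves all scalar factors and
    sums under one big sum over coordinates and leaves the scalar identity. *)
Ltac coordinatewise :=
  rewrite /inner !(mulrDr, mulrBr, mulrN, mulr_sumr)
    -?(sumrN, sumrB, big_split) /=;
  apply: eq_bigr => i _; rewrite ?mxE.

Lemma ge0_of_affine_ge0 {R : realFieldType} (a b : R) :
  (forall t, 0 < t <= 1 -> 0 <= a + t * b) -> 0 <= a.
Proof.
move=> h; rewrite leNgt; apply/negP => a0.
have b0 : 0 < b by have := h 1; lra.
(* The witness lies below the zero - a / b of t |-> a + t * b, and below 1. *)
have := h (- a / (b - a)).
rewrite divr_gt0 ?ler_pdivrMr ?mul1r ?subr_gt0 ?oppr_gt0; try lra.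
have -> : a + - a / (b - a) * b = - (a ^+ 2 / (b - a)).
  by field; lra.
have : 0 < a ^+ 2 / (b - a).
  by rewrite divr_gt0 ?subr_gt0 ?exprn_even_gt0 //=; lra.
lra.
Qed.

(** The first-order optimality condition of a proximal subproblem. The
    function h need not have a gradient, so the minimizer x1 is compared with
    the points x1 + t * (z - x1): convexity bounds the increment of h by
    t * (h z - h x1), and the quadratic term contributes its derivative times
    t, plus a multiple of t ^ 2 that disappears as t tends to 0. *)
Lemma argmin_prox_vi {R : realType} {l d : nat} (h : 'cV[R]_d -> R)
    (D : set 'cV[R]_d) (A : 'M[R]_(l, d)) (kappa tau : R)
    (x0 x1 z : 'cV[R]_d) (q : 'cV[R]_l) :
  convex_function [set: convex_lmodType 'cV[R]_d] h -> convex_set D ->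
  kappa != 0 ->
  is_argmin D (fun z => h z +
    kappa / 2 * enorm (A *m (z - x0) - (tau / kappa) *: q) ^+ 2) x1 ->
  D z ->
  0 <= h z - h x1
    + inner (A *m z - A *m x1) (kappa *: (A *m x1 - A *m x0) - tau *: q).
Proof.
move=> cvxh cvxD k0 [Dx1 minx1] Dz.
apply: (@ge0_of_affine_ge0 _ _
  (kappa / 2 * inner (A *m z - A *m x1) (A *m z - A *m x1))).
move=> t /andP[t0 t1].
pose T : {i01 R} := Itv01 (ltW t0) t1.
pose zt := t *: z + (1 - t) *: x1.
have Dzt : D zt.
  have := cvxD z x1 T; rewrite !inE => /(_ Dz Dx1).
  by rewrite /conv /=.
have hzt : h zt <= t * h z + (1 - t) * h x1.
  by have := cvxh T z x1; rewrite !inE => /(_ I I).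
have := minx1 _ Dzt; rewrite !sqr_enorm /zt !(mulmxBr, mulmxDr) -!scalemxAr.
set a := A *m z; set a1 := A *m x1; set a0 := A *m x0 => hmin.
rewrite -(pmulr_rge0 _ t0).
pose b := tau / kappa *: q.
have expand :
    kappa / 2 * inner (t *: a + (1 - t) *: a1 - a0 - b)
                      (t *: a + (1 - t) *: a1 - a0 - b)
    - kappa / 2 * inner (a1 - a0 - b) (a1 - a0 - b) =
    t * inner (a - a1) (kappa *: (a1 - a0) - tau *: q) +
    t * (t * (kappa / 2 * inner (a - a1) (a - a1))).
  by rewrite /b; coordinatewise; field.
move: hmin hzt expand; rewrite -/b -/zt !mulrDr !mulrN mulrBl mul1r; lra.
Qed.

(** * The variational inequality and the proximal metric *)

(** The iterates enter the algorithm through A and B only, so it is analysed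
    in the variables (A x, B y, lambda). *)
Definition mx_image {R : realType} {l m n : nat} (A : 'M[R]_(l, m))
    (B : 'M[R]_(l, n)) (w : 'cV[R]_m * 'cV[R]_n * 'cV[R]_l) :
    'cV[R]_l * 'cV[R]_l * 'cV[R]_l :=
  (A *m w.1.1, B *m w.1.2, w.2).

(** The number <w - w', J(w')> in terms of the images z of w and v of w' (see
    winner_Jop). *)
Definition saddle_form {R : realType} {l : nat} (tau : R) (c : 'cV[R]_l)
    (z v : 'cV[R]_l * 'cV[R]_l * 'cV[R]_l) : R :=
  tau * (inner (z.2 - v.2) (v.1.1 + v.1.2 - c)
         - inner (z.1.1 - v.1.1 + (z.1.2 - v.1.2)) v.2).

(** The symmetric bilinear form of the block matrix
      [[ sigma + (eps^2 - 1) / s,  0,  - eps ],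
       [ 0,  rho + (tau^2 - 1) / s,  - tau   ],
       [ - eps,  - tau,  s                   ]],
    for which the algorithm is a proximal point method. The first entry involves
    eps, unlike the parameter of the x-subproblem, which involves tau. *)
Definition prox_form {R : realType} {l : nat} (sigma rho s tau eps : R)
    (z v : 'cV[R]_l * 'cV[R]_l * 'cV[R]_l) : R :=
  pbar s eps sigma * inner z.1.1 v.1.1 + pbar s tau rho * inner z.1.2 v.1.2
  + s * inner z.2 v.2 - eps * (inner z.1.1 v.2 + inner z.2 v.1.1)
  - tau * (inner z.1.2 v.2 + inner z.2 v.1.2).

Lemma winner_Jop {R : realType} {l m n : nat} (A : 'M[R]_(l, m))
    (B : 'M[R]_(l, n)) (c : 'cV[R]_l) (tau : R)
    (w w' : 'cV[R]_m * 'cV[R]_n * 'cV[R]_l) :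
  winner (w - w') (Jop A B c tau w')
  = saddle_form tau c (mx_image A B w) (mx_image A B w').
Proof.
have -> : Jop A B c tau w' = (A^T *m (tau *: - w'.2), B^T *m (tau *: - w'.2),
    tau *: (A *m w'.1.1 + B *m w'.1.2 - c)).
  by rewrite /Jop -!scalemxAr !mulmxN.
rewrite /winner /= !inner_mulmx_tr !mulmxBr /saddle_form /=.
set a := A *m _; set a' := A *m _; set b := B *m _; set b' := B *m _.
by coordinatewise; ring.
Qed.

(** J is an affine map with skew-symmetric linear part, hence
    <w - w', J(w) - J(w')> vanishes. *)
Lemma saddle_form_skew {R : realType} {l : nat} (tau : R) (c : 'cV[R]_l)
    (z v : 'cV[R]_l * 'cV[R]_l * 'cV[R]_l) :
  saddle_form tau c z v = - saddle_form tau c v z.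
Proof. by rewrite /saddle_form; coordinatewise; ring. Qed.

Lemma cvg_saddle_form {R : realType} {T : Type} {F : set_system T}
    {FF : Filter F} {l : nat} (tau : R) (c : 'cV[R]_l)
    (z : 'cV[R]_l * 'cV[R]_l * 'cV[R]_l)
    (v : T -> 'cV[R]_l * 'cV[R]_l * 'cV[R]_l)
    (a : 'cV[R]_l * 'cV[R]_l * 'cV[R]_l) :
  v t @[t --> F] --> a ->
  saddle_form tau c z (v t) @[t --> F] --> saddle_form tau c z a.
Proof.
move=> /cvg_triple_proj[v1 v2 v3].
apply: cvgM; first exact: cvg_cst.
apply: cvgB; apply: cvg_inner => //.
- by apply: cvgB => //; exact: cvg_cst.
- by apply: cvgB; [exact: cvgD | exact: cvg_cst].
- by apply: cvgD; apply: cvgB => //; exact: cvg_cst.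
Qed.

Lemma prox_form0r {R : realType} {l : nat} (sigma rho s tau eps : R)
    (z : 'cV[R]_l * 'cV[R]_l * 'cV[R]_l) :
  prox_form sigma rho s tau eps z 0 = 0.
Proof.
have inner0r (u : 'cV[R]_l) : inner u 0 = 0.
  by apply: big1 => i _; rewrite mxE mulr0.
by rewrite /prox_form /= !inner0r !(mulr0, addr0, subr0).
Qed.

Lemma cvg_prox_form {R : realType} {T : Type} {F : set_system T}
    {FF : Filter F} {l : nat} (sigma rho s tau eps : R)
    (u v : T -> 'cV[R]_l * 'cV[R]_l * 'cV[R]_l)
    (a b : 'cV[R]_l * 'cV[R]_l * 'cV[R]_l) :
  u t @[t --> F] --> a -> v t @[t --> F] --> b ->
  prox_form sigma rho s tau eps (u t) (v t) @[t --> F]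
  --> prox_form sigma rho s tau eps a b.
Proof.
move=> /cvg_triple_proj[u1 u2 u3] /cvg_triple_proj[v1 v2 v3].
by repeat first [exact: cvg_cst | apply: cvg_inner; assumption
  | apply: cvgB | apply: cvgD | apply: cvgM].
Qed.

(** The law of cosines for the triangle z, u, v, in the form used to compare
    the distances to z before and after a step from u to v. *)
Lemma prox_form_square_sub {R : realType} {l : nat} (sigma rho s tau eps : R)
    (z u v : 'cV[R]_l * 'cV[R]_l * 'cV[R]_l) :
  let H := prox_form sigma rho s tau eps in
  H (v - z) (v - z)
  = H (u - z) (u - z) - H (v - u) (v - u) - 2 * H (z - v) (v - u).
Proof. by rewrite /prox_form /=; coordinatewise; ring. Qed.

(** Determinant over trace is lambda1 * lambda2 / (lambda1 + lambda2) in terms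
    of the eigenvalues, which lies below both of them. *)
Lemma quad2_coercive {R : realFieldType} (h11 h12 h22 a b : R) :
  0 < h11 -> 0 < h22 -> 0 < h11 * h22 - h12 ^+ 2 ->
  (h11 * h22 - h12 ^+ 2) / (h11 + h22) * (a ^+ 2 + b ^+ 2)
    <= h11 * a ^+ 2 - 2 * h12 * a * b + h22 * b ^+ 2.
Proof.
move=> p11 p22 det0.
have tr0 : 0 < h11 + h22 by lra.
have k0 : 0 < h11 ^+ 2 + h12 ^+ 2.
  by rewrite ltr_wpDr ?sqr_ge0// exprn_gt0.
rewrite -subr_ge0 -(pmulr_rge0 _ k0).
(* This completes the square: k0 / (h11 + h22) is the top left entry of the
   matrix of the form minus delta times the identity, with delta the constant
   of the statement and k0 = h11 ^+ 2 + h12 ^+ 2. *)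
have -> : (h11 ^+ 2 + h12 ^+ 2)
    * (h11 * a ^+ 2 - 2 * h12 * a * b + h22 * b ^+ 2
       - (h11 * h22 - h12 ^+ 2) / (h11 + h22) * (a ^+ 2 + b ^+ 2))
  = (((h11 ^+ 2 + h12 ^+ 2) * a - h12 * (h11 + h22) * b) ^+ 2
     + ((h11 * h22 - h12 ^+ 2) * b) ^+ 2) / (h11 + h22).
  by field; lra.
by rewrite divr_ge0 ?addr_ge0 ?sqr_ge0 ?ltW.
Qed.

(** Completing the square in the third component writes the form as
    s * (p - (eps * a + tau * b) / s) ^ 2 plus a form in (a, b) whose
    determinant is ((sigma s - 1) (rho s - 1) - tau^2 eps^2) / s^2: the
    conditions on the parameters are exactly those that make the matrix of
    prox_form positive definite. *)
Lemma prox_form_coercive {R : realType} {l : nat} (sigma rho s tau eps : R) :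
  0 < s -> s^-1 < sigma ->
  0 < (sigma * s - 1) * (rho * s - 1) - tau ^+ 2 * eps ^+ 2 ->
  exists2 delta : R, 0 < delta &
    forall z : 'cV[R]_l * 'cV[R]_l * 'cV[R]_l,
      delta * (inner z.1.1 z.1.1 + inner z.1.2 z.1.2 + inner z.2 z.2)
      <= prox_form sigma rho s tau eps z z.
Proof.
move=> s0 hsigma hrho.
have sn0 : s != 0 by rewrite gt_eqF.
(* Eliminating the multiplier from prox_form leaves the form with coefficients
   h11, - h12, h22 on the two other components. *)
pose h11 := sigma - s^-1; pose h22 := rho - s^-1; pose h12 := eps * tau / s.
have p11 : 0 < h11 by rewrite subr_gt0.
have det0 : 0 < h11 * h22 - h12 ^+ 2.
  suff -> : h11 * h22 - h12 ^+ 2 =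
    ((sigma * s - 1) * (rho * s - 1) - tau ^+ 2 * eps ^+ 2) / s ^+ 2.
    by rewrite divr_gt0 ?exprn_gt0.
  by rewrite /h11 /h22 /h12; field.
have p22 : 0 < h22.
  by rewrite -(pmulr_rgt0 _ p11); have := sqr_ge0 h12; lra.
pose d1 := (h11 * h22 - h12 ^+ 2) / (h11 + h22).
have d10 : 0 < d1 by rewrite divr_gt0// addr_gt0.
pose kap := 1 + 2 * ((eps / s) ^+ 2 + (tau / s) ^+ 2).
have kap0 : 0 < kap.
  by have := sqr_ge0 (eps / s); have := sqr_ge0 (tau / s); rewrite /kap; lra.
(* The first argument of min is dictated by the squares of the first two
   components, the second one by the completed square. *)
pose delta := Num.min (d1 / kap) (s / 2).
have delta0 : 0 < delta.
  by rewrite lt_min (divr_gt0 d10 kap0) (divr_gt0 s0 (ltr0n _ 2)).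
exists delta => // z.
have dd1 : delta * kap <= d1 by rewrite -ler_pdivlMr// ge_min lexx.
have ds : 2 * delta <= s.
  by rewrite mulrC -ler_pdivlMr// ge_min lexx orbT.
have -> : delta * (inner z.1.1 z.1.1 + inner z.1.2 z.1.2 + inner z.2 z.2) =
    \sum_(i < l) delta * (z.1.1 i 0 ^+ 2 + z.1.2 i 0 ^+ 2 + z.2 i 0 ^+ 2).
  by coordinatewise; ring.
have -> : prox_form sigma rho s tau eps z z = \sum_(i < l)
   (s * (z.2 i 0 - (eps / s * z.1.1 i 0 + tau / s * z.1.2 i 0)) ^+ 2
    + (h11 * z.1.1 i 0 ^+ 2 - 2 * h12 * z.1.1 i 0 * z.1.2 i 0
       + h22 * z.1.2 i 0 ^+ 2)).
  by rewrite /prox_form /pbar /h11 /h12 /h22; coordinatewise; field.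
apply: ler_sum => i _.
move: (z.1.1 i 0) (z.1.2 i 0) (z.2 i 0) => a b p.
have := @quad2_coercive _ h11 h12 h22 a b p11 p22 det0; rewrite -/d1.
set Q := (X in _ <= X) => hQ.
set w := eps / s * a + tau / s * b.
have hw : w ^+ 2 <= ((eps / s) ^+ 2 + (tau / s) ^+ 2) * (a ^+ 2 + b ^+ 2).
  by have := sqr_ge0 (eps / s * b - tau / s * a); rewrite /w; nra.
have hp : p ^+ 2 <= 2 * (p - w) ^+ 2 + 2 * w ^+ 2.
  by have := sqr_ge0 (p - 2 * w); nra.
have hab : 0 <= a ^+ 2 + b ^+ 2 by rewrite addr_ge0 ?sqr_ge0.
apply: (@le_trans _ _ (delta * (2 * (p - w) ^+ 2 + kap * (a ^+ 2 + b ^+ 2)))).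
  by rewrite ler_pM2l// /kap; lra.
rewrite mulrDr; apply: lerD.
  by rewrite mulrA ler_wpM2r ?sqr_ge0// mulrC.
apply: le_trans hQ; rewrite mulrA; exact: ler_wpM2r.
Qed.

(** * The algorithm as a proximal point method *)

Lemma pbar_gt0 {R : realType} (s tau p : R) :
  0 < s -> s^-1 < p -> 0 < pbar s tau p.
Proof.
move=> s0 sp; have -> : pbar s tau p = p - s^-1 + tau ^+ 2 / s.
  by rewrite /pbar mulrBl mul1r; lra.
by rewrite ltr_wpDr ?divr_ge0 ?sqr_ge0 ?subr_gt0// ltW.
Qed.

Lemma invs_lt_rho {R : realType} (sigma rho s t : R) :
  0 < s -> s^-1 < sigma -> 0 < (sigma * s - 1) * (rho * s - 1) - t ^+ 2 ->
  s^-1 < rho.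
Proof.
move=> s0 hsigma hrho.
have gt_invs p : (s^-1 < p) = (0 < p * s - 1).
  by rewrite subr_gt0 -ltr_pdivrMr// mul1r.
rewrite gt_invs in hsigma; rewrite gt_invs -(pmulr_rgt0 _ hsigma).
by have := sqr_ge0 t; lra.
Qed.

(** The identity that exhibits the algorithm as a proximal point method. The
    left side collects the linear terms of the optimality conditions of the
    two subproblems, with v and v' the old and new values of (A x, B y,
    lambda), and lb and lh the multipliers of the two subproblems. The update
    of the multiplier says that the components along z.2 - v'.2 of the two
    terms on the right cancel; this is the reason why the coefficients of
    lambda in the form are s, - eps and - tau. *)
Lemma pppa_residual_form {R : realType} {l : nat} (sigma rho s tau eps : R)
    (c : 'cV[R]_l) (z v v' : 'cV[R]_l * 'cV[R]_l * 'cV[R]_l)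
    (lb lh : 'cV[R]_l) :
  s != 0 ->
  lb = v.2 - ((tau + eps) / s) *: (v.1.1 + v.1.2 - c) ->
  lh = lb - ((tau - eps) / s) *: (2 *: v'.1.1 - v.1.1 + v.1.2 - c) ->
  v'.2 = v.2 - s^-1 *:
    ((tau - eps) *: v'.1.1 + eps *: v.1.1 + tau *: v.1.2 - tau *: c) ->
  inner (z.1.1 - v'.1.1) (pbar s tau sigma *: (v'.1.1 - v.1.1) - tau *: lb)
  + inner (z.1.2 - v'.1.2) (pbar s tau rho *: (v'.1.2 - v.1.2) - tau *: lh)
  = saddle_form tau c z v' + prox_form sigma rho s tau eps (z - v') (v' - v).
Proof.
case: z v v' => -[za zb] zp [[a b] p] [[a' b'] p'] /= s0 -> -> ->.
rewrite /saddle_form /prox_form /pbar /=.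
by coordinatewise; field.
Qed.

(** Adding the optimality conditions of the two subproblems gives the
    variational inequality of the problem at the new iterate, perturbed by
    prox_form applied to the step. *)
Lemma pppa_vi {R : realType} {l m n : nat}
    (f : 'cV[R]_m -> R) (g : 'cV[R]_n -> R)
    (A : 'M[R]_(l, m)) (B : 'M[R]_(l, n)) (c : 'cV[R]_l)
    (X : set 'cV[R]_m) (Y : set 'cV[R]_n)
    (sigma rho s tau eps : R)
    (x : nat -> 'cV[R]_m) (y : nat -> 'cV[R]_n)
    (lam lamb lambh r : nat -> 'cV[R]_l) :
  convex_function [set: convex_lmodType 'cV[R]_m] f ->
  convex_function [set: convex_lmodType 'cV[R]_n] g ->
  convex_set X -> convex_set Y ->
  0 < s -> s^-1 < sigma -> s^-1 < rho ->
  PPPA f g A B c X Y sigma rho s tau eps x y lam lamb lambh r ->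
  let v k := mx_image A B (x k, y k, lam k) in
  forall k w, Mset X Y w ->
  0 <= phi f g w.1 - phi f g (x k.+1, y k.+1)
       + saddle_form tau c (mx_image A B w) (v k.+1)
       + prox_form sigma rho s tau eps (mx_image A B w - v k.+1) (v k.+1 - v k).
Proof.
move=> cvxf cvxg cvxX cvxY s0 hsigma hrho alg v k [[wx wy] wl] [[/= Xwx Ywy] _].
have sigb0 : pbar s tau sigma != 0 by rewrite gt_eqF// pbar_gt0.
have rhob0 : pbar s tau rho != 0 by rewrite gt_eqF// pbar_gt0.
have hx := argmin_prox_vi f X A _ tau (x k) (x k.+1) wx (lamb k)
  cvxf cvxX sigb0 (pppa_x alg k) Xwx.
have hy := argmin_prox_vi g Y B _ tau (y k) (y k.+1) wy (lambh k)
  cvxg cvxY rhob0 (pppa_y alg k) Ywy.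
have lamS : lam k.+1 = lam k - s^-1 *: ((tau - eps) *: (A *m x k.+1)
    + eps *: (A *m x k) + tau *: (B *m y k) - tau *: c).
  have := pppa_lambS alg k.
  rewrite (pppa_lamb alg) (pppa_lamb alg) (pppa_r alg) !mulmxBr => /eqP.
  rewrite subr_eq => /eqP ->.
  move: (A *m x k.+1) (A *m x k) (B *m y k.+1) (B *m y k) => a' a b' b.
  by apply/matrixP => i j; rewrite !mxE; field; rewrite gt_eqF.
rewrite -addrA -(@pppa_residual_form _ _ sigma rho s tau eps c
  (mx_image A B (wx, wy, wl)) (v k) (v k.+1) (lamb k) (lambh k)) ?gt_eqF//.
- rewrite /phi /=; move: hx hy; lra.
- by rewrite (pppa_lamb alg).
- by rewrite (pppa_lambh alg) /= mulmxBr -scalemxAr.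
Qed.

(** The perturbed inequality at w1, tested at ws, and the inequality that
    defines ws, tested at w1, add up to 0 <= H (v ws - v w1) (v w1 - v w0),
    since the saddle terms cancel by skewness. The law of cosines turns this
    into a decrease of the distance to ws. *)
Lemma fejer_prox_form {R : realType} {l m n : nat}
    (f : 'cV[R]_m -> R) (g : 'cV[R]_n -> R)
    (A : 'M[R]_(l, m)) (B : 'M[R]_(l, n)) (c : 'cV[R]_l)
    (X : set 'cV[R]_m) (Y : set 'cV[R]_n) (sigma rho s tau eps : R)
    (w0 w1 ws : 'cV[R]_m * 'cV[R]_n * 'cV[R]_l) :
  let H := prox_form sigma rho s tau eps in
  let q z := H z z in
  let v := mx_image A B in
  Mset X Y w1 -> Mstar f g A B c X Y tau ws ->
  0 <= phi f g ws.1 - phi f g w1.1 + saddle_form tau c (v ws) (v w1)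
       + H (v ws - v w1) (v w1 - v w0) ->
  q (v w1 - v ws) <= q (v w0 - v ws) - q (v w1 - v w0).
Proof.
move=> H q v Mw1 [_ /(_ _ Mw1)] opt; rewrite winner_Jop saddle_form_skew in opt.
move=> step; rewrite /q /H (prox_form_square_sub _ _ _ _ _ (v ws) (v w0)) -/H.
by rewrite gerBl; move: opt step; rewrite /H /v; lra.
Qed.

(** In the limit along a subsequence the perturbation vanishes, because
    v (k j) and v (k j).+1 have the same limit. Lower semicontinuity of f and g
    preserves the inequality, as f (x (k j).+1) and g (y (k j).+1) enter it
    with a negative sign. *)
Lemma pppa_cluster_in_Mstar {R : realType} {l m n : nat}
    (f : 'cV[R]_m -> R) (g : 'cV[R]_n -> R)
    (A : 'M[R]_(l, m)) (B : 'M[R]_(l, n)) (c : 'cV[R]_l)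
    (X : set 'cV[R]_m) (Y : set 'cV[R]_n) (sigma rho s tau eps : R)
    (x : nat -> 'cV[R]_m) (y : nat -> 'cV[R]_n) (lam : nat -> 'cV[R]_l)
    (k : nat -> nat) (ws : 'cV[R]_m * 'cV[R]_n * 'cV[R]_l) :
  lower_semicontinuous (EFin \o f) -> lower_semicontinuous (EFin \o g) ->
  closed X -> closed Y ->
  (forall j, X (x j.+1)) -> (forall j, Y (y j.+1)) ->
  let v j := mx_image A B (x j, y j, lam j) in
  (forall j w, Mset X Y w ->
     0 <= phi f g w.1 - phi f g (x j.+1, y j.+1)
       + saddle_form tau c (mx_image A B w) (v j.+1)
       + prox_form sigma rho s tau eps
           (mx_image A B w - v j.+1) (v j.+1 - v j)) ->
  x (k j).+1 @[j --> \oo] --> ws.1.1 -> y (k j).+1 @[j --> \oo] --> ws.1.2 ->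
  v (k j) @[j --> \oo] --> mx_image A B ws ->
  v (k j).+1 @[j --> \oo] --> mx_image A B ws ->
  Mstar f g A B c X Y tau ws.
Proof.
move=> lf lg clX clY Xx Yy v vi xk yk vk vSk.
split.
  split=> //; split.
    apply: (closed_cvg (fun u => X u) clX _ _ xk); exact: nearW.
  apply: (closed_cvg (fun u => Y u) clY _ _ yk); exact: nearW.
move=> w Mw; rewrite winner_Jop.
suff : f ws.1.1 + g ws.1.2 <= phi f g w.1
    + saddle_form tau c (mx_image A B w) (mx_image A B ws)
    + prox_form sigma rho s tau eps (mx_image A B w - mx_image A B ws)
        (mx_image A B ws - mx_image A B ws).
  rewrite subrr prox_form0r; move: (saddle_form _ _ _ _) => a.
  by rewrite {3}/phi; lra.
apply: (lsc_sum_le_lim f g _ _ _ _ (fun j => phi f g w.1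
    + saddle_form tau c (mx_image A B w) (v (k j).+1)
    + prox_form sigma rho s tau eps (mx_image A B w - v (k j).+1)
        (v (k j).+1 - v (k j))) _ lf lg xk yk).
  apply: cvgD.
    by apply: cvgD; [exact: cvg_cst | exact: cvg_saddle_form].
  by apply: cvg_prox_form; apply: cvgB => //; exact: cvg_cst.
by move=> j; have := vi (k j) _ Mw; rewrite {2}/phi /=; lra.
Qed.

(** * Convergence *)

Theorem theorem1 (R : realType) (l m n : nat)
    (f : 'cV[R]_m -> R) (g : 'cV[R]_n -> R)
    (A : 'M[R]_(l, m)) (B : 'M[R]_(l, n)) (c : 'cV[R]_l)
    (X : set 'cV[R]_m) (Y : set 'cV[R]_n)
    (sigma rho s tau eps : R)
    (x : nat -> 'cV[R]_m) (y : nat -> 'cV[R]_n)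
    (lam lamb lambh r : nat -> 'cV[R]_l)
    (hf : closed_proper_convex f) (hg : closed_proper_convex g)
    (clX : closed X) (cvxX : convex_set X)
    (clY : closed Y) (cvxY : convex_set Y)
    (hsol : solution_set f g A B c X Y !=set0)
    (hA : full_column_rank A) (hB : full_column_rank B)
    (hM : Mstar f g A B c X Y tau !=set0)
    (hs : 0 < s) (hsigma : s^-1 < sigma)
    (hrho : 0 < (sigma * s - 1) * (rho * s - 1) - tau ^+ 2 * eps ^+ 2)
    (htau : tau != 0)
    (halg : PPPA f g A B c X Y sigma rho s tau eps x y lam lamb lambh r) :
  exists winf : 'cV[R]_m * 'cV[R]_n * 'cV[R]_l,
    Mstar f g A B c X Y tau winf /\
    (fun k => (x k, y k, lam k)) @ \oo --> winf.
Proof.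
have [lf _ cf] := hf; have [lg _ cg] := hg.
have rho_gt : s^-1 < rho.
  by apply: (@invs_lt_rho _ sigma rho s (tau * eps)); rewrite ?exprMn.
have vi := pppa_vi f g A B c X Y sigma rho s tau eps x y lam lamb lambh r
  cf cg cvxX cvxY hs hsigma rho_gt halg.
pose v k := mx_image A B (x k, y k, lam k).
pose H := @prox_form R l sigma rho s tau eps.
have [delta delta0 coercive] :=
  @prox_form_coercive R l _ _ _ _ _ hs hsigma hrho.
have Xx k : X (x k.+1) := (pppa_x halg k).1.
have Yy k : Y (y k.+1) := (pppa_y halg k).1.
have [a [ws Mws wsa] va] : exists2 a,
    (mx_image A B @` Mstar f g A B c X Y tau) a & v k @[k --> \oo] --> a.
  apply: (@fejer_cvg _ _ (fun z => H z z) delta) => //.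
  - move=> z; apply: le_trans (coercive z).
    by rewrite ler_pM2l// sqr_norm_triple_le.
  - exact: prox_form0r.
  - exact: cvg_prox_form.
  - exact: compact_triple_ball.
  - by have [ws Mws] := hM; exists (mx_image A B ws), ws.
  - move=> _ k [ws Mws <-].
    apply: (fejer_prox_form _ _ _ _ _ _ _ _ _ _ _ _
      (x k, y k, lam k) (x k.+1, y k.+1, lam k.+1) _ _ Mws) => //.
      by split=> //; split; [exact: Xx | exact: Yy].
    exact: vi k ws Mws.1.
  - move=> k a koo vk vSk.
    have [ak bk pk] := cvg_triple_proj _ _ vk.
    have [aSk bSk pSk] := cvg_triple_proj _ _ vSk.
    pose ws := (pinvmx A *m a.1.1, pinvmx B *m a.1.2, a.2).
    have wsa : mx_image A B ws = a.
      rewrite /mx_image /ws /= (mulmx_pinv_lim _ _ _ hA ak).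
      by rewrite (mulmx_pinv_lim _ _ _ hB bk); case: (a) => -[].
    exists ws => //.
    apply: (pppa_cluster_in_Mstar f g A B c X Y sigma rho s tau eps x y lam k)
      => //.
    + exact: cvg_full_column_rank hA aSk.
    + exact: cvg_full_column_rank hB bSk.
    + by rewrite wsa.
    + by rewrite wsa.
have [ak bk pk] := cvg_triple_proj _ _ va; rewrite -wsa /= in ak bk pk.
exists ws; split => //.
have xk : x k @[k --> \oo] --> pinvmx A *m (A *m ws.1.1).
  exact: cvg_full_column_rank.
have yk : y k @[k --> \oo] --> pinvmx B *m (B *m ws.1.2).
  exact: cvg_full_column_rank.
rewrite !mulmxA !mulVpmx_full_column_rank// !mul1mx in xk yk.
exact: cvg_triple_intro xk yk pk.
Qed.
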